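(* Let $E_\mu=\mathbb{R}^{n_\mu}$ and let $M_\mu\in\mathbb{R}^{n_\mu\times n_\mu}$ be symmetric positive definite for $\mu\in\{1,2,3\}$. Let $\mathcal{S}_M$ be $E_1\otimes E_2\otimes E_3$ endowed with the inner product induced by $M_1,M_2,M_3$, let $\mathcal{S}$ be the same space with the standard inner product, and let $\nu:\mathcal{S}_M\to\mathcal{S}$, $\nu(\mathbf{A})=(M_1,M_2,M_3)\mathbf{A}$. Let $\mathbf{F}\in\mathcal{S}_M$ and let $\mathbf{X}=\nu(\mathbf{F})$ be its image in $\mathcal{S}$. Let $(U_\mu)_\mu$, $U_\mu\in\mathbb{R}^{n_\mu\times r_\mu}$, be the HOSVD basis and $\mathbf{C}$ the HOSVD core tensor of $\mathbf{X}$ at multilinear rank $\mathbf{r}=(r_1,r_2,r_3)$, with $r_\mu\le\operatorname{rank}(X^{(\mu)})$ for $\mu\in\{1,2,3\}$, so that $\mathbf{X}$ is expressed as $\mathbf{X}=(U_1,U_2,U_3)\mathbf{C}$. Let $\Sigma_\mu$ be the diagonal matrix of singular values of $X^{(\mu)}$ associated with the columns of $U_\mu$, let $Y_\mu=U_\mu\Sigma_\mu$, and let $W_\mu=M_\mu^{-1}Y_\mu$ be the principal components of mode $\mu$ of $\mathbf{F}$ in $\mathcal{S}_M$. Then $$\begin{aligned} W_1&=F^{(1)}(M_3^2W_3\otimes_K M_2^2W_2)(B^{(1)})^{T},\\ W_2&=F^{(2)}(M_3^2W_3\otimes_K M_1^2W_1)(B^{(2)})^{T},\\ W_3&=F^{(3)}(M_2^2W_2\otimes_K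 M_1^2W_1)(B^{(3)})^{T}, \end{aligned}$$ where $\mathbf{B}=(\Sigma_1^{-1},\Sigma_2^{-1},\Sigma_3^{-1})\mathbf{C}$.
   Context: For a tensor $\mathbf{A}\in\mathbb{R}^{n_1\times\dots\times n_d}$, the matricization $A^{(\mu)}$ with respect to mode $\mu$ is the matrix with $n_\mu$ rows and $\prod_{\alpha\neq\mu}n_\alpha$ columns whose entry in row $i_\mu$ and column $\overline{i_1,\dots,i_{\mu-1},i_{\mu+1},\dots,i_d}=1+\sum_{\alpha\ne\mu}(i_\alpha-1)m_\alpha$, with $m_\alpha=\prod_{\beta<\alpha,\ \beta\neq\mu}n_\beta$, is $A_{i_1\dots i_d}$. $\otimes_K$ is the Kronecker product of matrices. For matrices $M_\mu$ of compatible size, $(M_1,\dots,M_d)\mathbf{A}$ is the tensor-times-matrix product: $(M_1,\dots,M_d)(\mathbf{a}_1\otimes\dots\otimes\mathbf{a}_d)=M_1\mathbf{a}_1\otimes\dots\otimes M_d\mathbf{a}_d$, extended linearly. The inner product on $E_\mu$ induced by $M_\mu$ is $\langle\mathbf{a},\mathbf{a}'\rangle_{M_\mu}=\langle M_\mu\mathbf{a},M_\mu\mathbf{a}'\rangle$, and on the tensor space it is $\langle\mathbf{A},\mathbf{A}'\rangle=\langle(M_1,\dots,M_d)\mathbf{A},(M_1,\dots,M_d)\mathbf{A}'\rangle$, so $\nu$ is an isometry. HOSVD of $\mathbf{X}$ at multilinear rank $\mathbf{r}$: for each mode $\mu$, the matrix $U_\mu\in\mathbb{R}^{n_\mu\times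 r_\mu}$ has as its columns orthonormal left singular vectors of $X^{(\mu)}$ associated with its $r_\mu$ largest singular values $\sigma^{(\mu)}_1\ge\dots\ge\sigma^{(\mu)}_{r_\mu}$; $\Sigma_\mu=\operatorname{diag}(\sigma^{(\mu)}_1,\dots,\sigma^{(\mu)}_{r_\mu})$; and the core is $\mathbf{C}=(U_1^{T},\dots,U_d^{T})\mathbf{X}$. *)

(* Defs.v *)
From mathcomp Require Import all_boot all_order all_algebra.
From mathcomp Require Import ring reals.
From mathcomp Require Export mxtens.

Set Implicit Arguments.
Unset Strict Implicit.
Unset Printing Implicit Defensive.

Import Order.TTheory GRing.Theory Num.Theory.
Local Open Scope ring_scope.

Notation "''T[' R ]_ ( n1 , n2 , n3 )" :=
  {ffun 'I_n1 * 'I_n2 * 'I_n3 -> R}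
  (at level 0, n1, n2, n3 at level 99, format "''T[' R ]_ ( n1 ,  n2 ,  n3 )")
  : type_scope.

Section Tensors.
Variable R : comNzRingType.

Definition otimes3 n1 n2 n3 (a1 : 'cV[R]_n1) (a2 : 'cV[R]_n2) (a3 : 'cV[R]_n3) :
    'T[R]_(n1, n2, n3) :=
  [ffun i => a1 i.1.1 0 * a2 i.1.2 0 * a3 i.2 0].

(* The linear extension of ttm_otimes3 below.                                 *)
Definition ttm n1 n2 n3 m1 m2 m3
    (M1 : 'M[R]_(m1, n1)) (M2 : 'M[R]_(m2, n2)) (M3 : 'M[R]_(m3, n3))
    (A : 'T[R]_(n1, n2, n3)) : 'T[R]_(m1, m2, m3) :=
  [ffun k => \sum_i M1 k.1.1 i.1.1 * M2 k.1.2 i.1.2 * M3 k.2 i.2 * A i].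

Lemma ttmD n1 n2 n3 m1 m2 m3
    (M1 : 'M[R]_(m1, n1)) (M2 : 'M[R]_(m2, n2)) (M3 : 'M[R]_(m3, n3))
    (A B : 'T[R]_(n1, n2, n3)) :
  ttm M1 M2 M3 (A + B) = ttm M1 M2 M3 A + ttm M1 M2 M3 B.
Proof.
apply/ffunP => k; rewrite !ffunE -big_split /=.
by apply: eq_bigr => i _; rewrite !ffunE mulrDr.
Qed.

Lemma ttmZ n1 n2 n3 m1 m2 m3
    (M1 : 'M[R]_(m1, n1)) (M2 : 'M[R]_(m2, n2)) (M3 : 'M[R]_(m3, n3))
    (c : R) (A : 'T[R]_(n1, n2, n3)) :
  ttm M1 M2 M3 [ffun i => c * A i] = [ffun k => c * ttm M1 M2 M3 A k].
Proof.
apply/ffunP => k; rewrite !ffunE big_distrr /=.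
by apply: eq_bigr => i _; rewrite !ffunE mulrCA.
Qed.

Lemma ttm_otimes3 n1 n2 n3 m1 m2 m3
    (M1 : 'M[R]_(m1, n1)) (M2 : 'M[R]_(m2, n2)) (M3 : 'M[R]_(m3, n3)) a1 a2 a3 :
  ttm M1 M2 M3 (otimes3 a1 a2 a3) = otimes3 (M1 *m a1) (M2 *m a2) (M3 *m a3).
Proof.
apply/ffunP => k; rewrite !ffunE !mxE.
rewrite big_distrlr /= pair_big /= big_distrlr /= pair_big /=.
by apply: eq_bigr => i _; rewrite ffunE; ring.
Qed.

(* With 0-based indices, mxtens_index (j, i) : 'I_(p * n) has value j * n + i. *)
(* The columns of a matricization are therefore ordered with the lowest        *)
(* remaining mode varying fastest, and this is also the ordering for which     *)
(* A *t B is the Kronecker product of A and B.                                 *)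
Definition unfold1 n1 n2 n3 (A : 'T[R]_(n1, n2, n3)) : 'M[R]_(n1, n3 * n2) :=
  \matrix_(i, j) A (i, (mxtens_unindex j).2, (mxtens_unindex j).1).

Definition unfold2 n1 n2 n3 (A : 'T[R]_(n1, n2, n3)) : 'M[R]_(n2, n3 * n1) :=
  \matrix_(i, j) A ((mxtens_unindex j).2, i, (mxtens_unindex j).1).

Definition unfold3 n1 n2 n3 (A : 'T[R]_(n1, n2, n3)) : 'M[R]_(n3, n2 * n1) :=
  \matrix_(i, j) A ((mxtens_unindex j).2, (mxtens_unindex j).1, i).

Lemma unfold1E n1 n2 n3 (A : 'T[R]_(n1, n2, n3)) i1 i2 i3 :
  unfold1 A i1 (mxtens_index (i3, i2)) = A (i1, i2, i3).
Proof. by rewrite mxE mxtens_indexK. Qed.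

Lemma unfold2E n1 n2 n3 (A : 'T[R]_(n1, n2, n3)) i1 i2 i3 :
  unfold2 A i2 (mxtens_index (i3, i1)) = A (i1, i2, i3).
Proof. by rewrite mxE mxtens_indexK. Qed.

Lemma unfold3E n1 n2 n3 (A : 'T[R]_(n1, n2, n3)) i1 i2 i3 :
  unfold3 A i3 (mxtens_index (i2, i1)) = A (i1, i2, i3).
Proof. by rewrite mxE mxtens_indexK. Qed.

Definition tdot n1 n2 n3 (A B : 'T[R]_(n1, n2, n3)) : R := \sum_i A i * B i.

(* S_M has the same underlying space as S; it differs by its inner product,   *)
(* tdot_weighted, for which nu is an isometry by definition.                  *)
Definition nu n1 n2 n3 (M1 : 'M[R]_n1) (M2 : 'M[R]_n2) (M3 : 'M[R]_n3)
    (A : 'T[R]_(n1, n2, n3)) : 'T[R]_(n1, n2, n3) :=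
  ttm M1 M2 M3 A.

Definition tdot_weighted n1 n2 n3
    (M1 : 'M[R]_n1) (M2 : 'M[R]_n2) (M3 : 'M[R]_n3)
    (A B : 'T[R]_(n1, n2, n3)) : R :=
  tdot (nu M1 M2 M3 A) (nu M1 M2 M3 B).

Definition hosvd_core n1 n2 n3 r1 r2 r3
    (U1 : 'M[R]_(n1, r1)) (U2 : 'M[R]_(n2, r2)) (U3 : 'M[R]_(n3, r3))
    (X : 'T[R]_(n1, n2, n3)) : 'T[R]_(r1, r2, r3) :=
  ttm U1^T U2^T U3^T X.

End Tensors.

Section Spectral.
Variable R : realType.

Definition spd n (M : 'M[R]_n) : Prop :=
  M^T = M /\ forall x : 'cV[R]_n, x != 0 -> 0 < (x^T *m M *m x) 0 0.

(* s lists the minn m n singular values of A with multiplicity, in            *)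
(* nonincreasing order.                                                       *)
Definition singular_values m n (A : 'M[R]_(m, n)) (s : seq R) : Prop :=
  [/\ size s = minn m n, all (fun x => 0 <= x) s, sorted >=%R s
    & exists P : 'M[R]_m, exists Q : 'M[R]_n,
        [/\ P^T *m P = 1%:M, Q^T *m Q = 1%:M
          & A = P *m (\matrix_(i < m, j < n) (s`_i *+ (i == j :> nat))) *m Q^T]].

Definition left_singular_vector m n (A : 'M[R]_(m, n)) (sigma : R)
    (u : 'cV[R]_m) : Prop :=
  u^T *m u = 1%:M /\
  exists v : 'cV[R]_n,
    [/\ v^T *m v = 1%:M, A *m v = sigma *: u & A^T *m u = sigma *: v].

Definition leading_left_singular_vectors m n r (A : 'M[R]_(m, n))
    (U : 'M[R]_(m, r)) (sigma : 'rV[R]_r) : Prop :=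
  exists s : seq R,
    [/\ singular_values A s, (r <= size s)%N, forall k, sigma 0 k = s`_k,
        U^T *m U = 1%:M
      & forall k, left_singular_vector A (sigma 0 k) (col k U)].

Definition hosvd_basis n1 n2 n3 r1 r2 r3 (X : 'T[R]_(n1, n2, n3))
    (U1 : 'M[R]_(n1, r1)) (U2 : 'M[R]_(n2, r2)) (U3 : 'M[R]_(n3, r3))
    (sigma1 : 'rV[R]_r1) (sigma2 : 'rV[R]_r2) (sigma3 : 'rV[R]_r3) : Prop :=
  [/\ leading_left_singular_vectors (unfold1 X) U1 sigma1,
      leading_left_singular_vectors (unfold2 X) U2 sigma2
    & leading_left_singular_vectors (unfold3 X) U3 sigma3].

End Spectral.

(* Main.v *)
Require Import Defs.
From mathcomp Require Import all_boot all_order all_algebra.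
From mathcomp Require Import ring reals.

Set Implicit Arguments.
Unset Strict Implicit.
Unset Printing Implicit Defensive.

Import Order.TTheory GRing.Theory Num.Theory.
Local Open Scope ring_scope.

(** Matricize in mode [1].  Then [X = nu F] reads
    [X1 = M1 *m F1 *m (M3 *t M2)^T], and [X = ttm U1 U2 U3 C] reads
    [X1 = U1 *m C1 *m (U3 *t U2)^T]; both are instances of the rule
    that turns mode products into Kronecker products ([unfold1_ttm] and its
    siblings).  In the right-hand side of the claim each [M^2 W] equals
    [M U Sigma], and the [Sigma3], [Sigma2] cancel against the inverses inside
    [B1], leaving
    [F1 *m (M3 *t M2) *m (U3 *t U2) *m C1^T *m Sigma1^-1].  As the [M]'s are
    symmetric, [F1 *m (M3 *t M2)] is [M1^-1 *m X1]; as [U1] has orthonormal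
    columns, [(U3 *t U2) *m C1^T] is [X1^T *m U1].  What is left is
    [M1^-1 *m (X1 *m X1^T *m U1) *m Sigma1^-1], and the columns of [U1] are
    eigenvectors of [X1 *m X1^T] for the squared singular values, so this is
    [M1^-1 *m U1 *m Sigma1 = W1].

    The computation is the same for the three modes and is done once, for
    matrices, in [principal_components_fixpoint].  The rank hypotheses serve
    to make every [Sigma] invertible ([leading_singular_values_unit]): the
    first [\rank A] singular values of [A] are nonzero. *)

Section Unfolding.
Variable R : comNzRingType.

(** The common right-hand side of the three unfolding rules below: in this
    form the modes differ only by the order of the three summations. *)
Lemma kronecker_rowE n p q m p' q'
    (A : 'M[R]_(m, n)) (T : 'M[R]_(n, p * q)) (B : 'M[R]_(p', p))
    (C : 'M[R]_(q', q)) i k l :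
  (A *m T *m (B *t C)^T) i (mxtens_index (k, l)) =
  \sum_a \sum_b \sum_c A i a * B k b * C l c * T a (mxtens_index (b, c)).
Proof.
rewrite -mulmxA mxE; apply: eq_bigr => a _; rewrite mxE big_distrr /=.
rewrite pair_bigA /= (reindex (@mxtens_index p q)) /=; last first.
  exists (@mxtens_unindex p q) => x _.
    exact: mxtens_indexK.
  exact: mxtens_unindexK.
by apply: eq_bigr => -[b c] _ /=; rewrite mxE tensmxE; ring.
Qed.

Section TensorTimesMatrix.
Variables (n1 n2 n3 m1 m2 m3 : nat).
Variables (A1 : 'M[R]_(m1, n1)) (A2 : 'M[R]_(m2, n2)) (A3 : 'M[R]_(m3, n3)).
Variable T : 'T[R]_(n1, n2, n3).

Lemma ttmE i1 i2 i3 :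
  ttm A1 A2 A3 T (i1, i2, i3) =
  \sum_a1 \sum_a2 \sum_a3 A1 i1 a1 * A2 i2 a2 * A3 i3 a3 * T (a1, a2, a3).
Proof.
rewrite ffunE pair_bigA pair_bigA /=.
by apply: eq_bigr => -[[a1 a2] a3].
Qed.

Lemma unfold1_ttm :
  unfold1 (ttm A1 A2 A3 T) = A1 *m unfold1 T *m (A3 *t A2)^T.
Proof.
apply/matrixP => i j; case: (mxtens_indexP j) => k l.
rewrite unfold1E ttmE kronecker_rowE; apply: eq_bigr => a _.
rewrite exchange_big /=; apply: eq_bigr => b _; apply: eq_bigr => c _.
by rewrite unfold1E; ring.
Qed.

Lemma unfold2_ttm :
  unfold2 (ttm A1 A2 A3 T) = A2 *m unfold2 T *m (A3 *t A1)^T.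
Proof.
apply/matrixP => i j; case: (mxtens_indexP j) => k l.
rewrite unfold2E ttmE kronecker_rowE exchange_big /=; apply: eq_bigr => a _.
rewrite exchange_big /=; apply: eq_bigr => b _; apply: eq_bigr => c _.
by rewrite unfold2E; ring.
Qed.

Lemma unfold3_ttm :
  unfold3 (ttm A1 A2 A3 T) = A3 *m unfold3 T *m (A2 *t A1)^T.
Proof.
apply/matrixP => i j; case: (mxtens_indexP j) => k l.
rewrite unfold3E ttmE kronecker_rowE [LHS]exchange_big [RHS]exchange_big /=.
apply: eq_bigr => b _; rewrite exchange_big /=.
by apply: eq_bigr => a _; apply: eq_bigr => c _; rewrite unfold3E; ring.
Qed.

End TensorTimesMatrix.
End Unfolding.

Section Spectral.
Variable R : realType.

Lemma spd_unit n (M : 'M[R]_n) : spd M -> M \in unitmx.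
Proof.
case=> _ posM; rewrite -row_free_unit; apply: inj_row_free => v vM0.
apply/eqP; apply: contraT => v_neq0.
have vT_neq0 : v^T != 0 by rewrite -(inj_eq trmx_inj) trmxK trmx0.
by have := posM _ vT_neq0; rewrite trmxK vM0 mul0mx mxE ltxx.
Qed.

(** If [s`_k] were zero, monotonicity and nonnegativity would make all later
    singular values vanish too, so the diagonal factor would live on its first
    [k] rows and the rank would be at most [k]. *)
Lemma singular_value_neq0 m n (A : 'M[R]_(m, n)) (s : seq R) k :
  singular_values A s -> (k < \rank A)%N -> s`_k != 0.
Proof.
case=> size_s s_ge0 s_sorted [P [Q [_ _ A_svd]]]; apply: contraTneq => sk0.
rewrite -leqNgt.
have [k_lt_m | m_le_k] := ltnP k m; last exact: leq_trans (rank_leq_row A) _.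
set D := (X in P *m X *m _) in A_svd.
have tail0 j : (k <= j)%N -> s`_j = 0.
  move=> kj; have [js | /(nth_default 0)//] := ltnP j (size s).
  apply/eqP; rewrite eq_le (allP s_ge0) ?mem_nth // andbT -[leRHS]sk0.
  have ge_tr : transitive (>=%R : rel R).
    by move=> y x z xy yz; apply: le_trans xy.
  by apply: (sorted_leq_nth ge_tr lexx) => //; rewrite inE (leq_ltn_trans kj).
have D_supp : D = (pid_mx k : 'M_m) *m D.
  apply/matrixP => i j; rewrite [RHS]mxE (bigD1 i) //= big1 => [|l l_neq_i].
    rewrite !mxE eqxx /= addr0; case: ltnP => [_ | ki]; first by rewrite mul1r.
    by rewrite tail0 ?mul0rn ?mulr0.
  by rewrite mxE eq_sym (negPf (_ : l != i :> nat)) // mul0r.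
apply: (@leq_trans (\rank D)).
  by rewrite A_svd (leq_trans (mxrankM_maxl _ _)) ?mxrankM_maxr.
rewrite D_supp (leq_trans (mxrankM_maxl _ _)) // rank_pid_mx // ltnW //.
Qed.

Lemma leading_singular_values_unit m n r (A : 'M[R]_(m, n)) U
    (sigma : 'rV[R]_r) :
  leading_left_singular_vectors A U sigma -> (r <= \rank A)%N ->
  diag_mx sigma \in unitmx.
Proof.
case=> s [s_sv _ sigmaE _ _] r_rank; rewrite unitmxE det_diag unitfE.
apply/prodf_neq0 => k _.
by rewrite sigmaE (singular_value_neq0 s_sv) // (leq_trans (ltn_ord k)).
Qed.

(** Composing the two equations of a singular pair gives an eigenvector of
    [A *m A^T]; the square of [diag_mx sigma] is left as two factors because
    one of them is to be cancelled. *)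
Lemma leading_left_singular_vectorsM m n r (A : 'M[R]_(m, n)) U
    (sigma : 'rV[R]_r) :
  leading_left_singular_vectors A U sigma ->
  A *m (A^T *m U) = U *m diag_mx sigma *m diag_mx sigma.
Proof.
case=> s [_ _ _ _ U_sv]; apply/matrixP => i k.
have [_ [v [_ Av Au]]] := U_sv k.
have -> : (A *m (A^T *m U)) i k = col k (A *m (A^T *m U)) i 0.
  by rewrite [RHS]mxE.
rewrite colE -!mulmxA -colE Au -scalemxAr Av mulmxA !mul_mx_diag !mxE /=.
by rewrite mulrC [sigma 0 k * _]mulrC.
Qed.

(** One mode of the tensor statement, with the other two modes entering only
    through Kronecker products: [F] and [X] stand for the matricizations and
    [C] for that of the core. *)
Lemma principal_components_fixpoint n p q r s t
    (M : 'M[R]_n) (P : 'M[R]_p) (Q : 'M[R]_q) (F X : 'M[R]_(n, p * q))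
    (U : 'M[R]_(n, r)) (V : 'M[R]_(p, s)) (W : 'M[R]_(q, t))
    (C : 'M[R]_(r, s * t))
    (sigma : 'rV[R]_r) (DV : 'M[R]_s) (DW : 'M[R]_t) :
  spd M -> spd P -> spd Q ->
  leading_left_singular_vectors X U sigma ->
  diag_mx sigma \in unitmx -> DV \in unitmx -> DW \in unitmx ->
  X = M *m F *m (P *t Q)^T -> X = U *m C *m (V *t W)^T ->
  invmx M *m (U *m diag_mx sigma) =
    F *m ((P ^+ 2 *m (invmx P *m (V *m DV)))
            *t (Q ^+ 2 *m (invmx Q *m (W *m DW))))
      *m (invmx (diag_mx sigma) *m C *m (invmx DV *t invmx DW)^T)^T.
Proof.
move=> spdM spdP spdQ U_lead unitS unitV unitW X_F X_C.
have [[PT _] [QT _]] := (spdP, spdQ).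
have unitM := spd_unit spdM.
have sqrK k l (N : 'M[R]_k) (Z : 'M[R]_(k, l)) :
    spd N -> N ^+ 2 *m (invmx N *m Z) = N *m Z.
  by move=> /spd_unit uN; rewrite expr2 -[N * N]/(N *m N) -mulmxA mulKVmx.
have UTU : U^T *m U = 1%:M by case: U_lead => ? [].
have XTU : X^T *m U = (V *t W) *m C^T.
  by rewrite X_C !trmx_mul trmxK -!mulmxA UTU mulmx1.
have FPQ : F *m (P *t Q) = invmx M *m X.
  by rewrite X_F trmx_tens PT QT -mulmxA mulKmx.
rewrite !sqrK // !mulmxA -!tensmx_mul !trmx_mul trmxK trmx_inv tr_diag_mx.
rewrite !mulmxA.
have -> : F *m (P *t Q) *m (V *t W) *m (DV *t DW) *m (invmx DV *t invmx DW)
            = F *m (P *t Q) *m (V *t W).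
  by rewrite -!mulmxA !tensmx_mul !mulmxV // !mulmx1.
rewrite FPQ -!mulmxA (mulmxA (V *t W)) -XTU (mulmxA X).
by rewrite (leading_left_singular_vectorsM U_lead) mulmxK.
Qed.

End Spectral.

Theorem proposition3 (R : realType) (n1 n2 n3 r1 r2 r3 : nat)
    (M1 : 'M[R]_n1) (M2 : 'M[R]_n2) (M3 : 'M[R]_n3)
    (F : 'T[R]_(n1, n2, n3))
    (U1 : 'M[R]_(n1, r1)) (U2 : 'M[R]_(n2, r2)) (U3 : 'M[R]_(n3, r3))
    (sigma1 : 'rV[R]_r1) (sigma2 : 'rV[R]_r2) (sigma3 : 'rV[R]_r3) :
  spd M1 -> spd M2 -> spd M3 ->
  let X := nu M1 M2 M3 F in
  hosvd_basis X U1 U2 U3 sigma1 sigma2 sigma3 ->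
  (r1 <= \rank (unfold1 X))%N ->
  (r2 <= \rank (unfold2 X))%N ->
  (r3 <= \rank (unfold3 X))%N ->
  let C := hosvd_core U1 U2 U3 X in
  X = ttm U1 U2 U3 C ->
  let Sigma1 := diag_mx sigma1 in
  let Sigma2 := diag_mx sigma2 in
  let Sigma3 := diag_mx sigma3 in
  let Y1 := U1 *m Sigma1 in
  let Y2 := U2 *m Sigma2 in
  let Y3 := U3 *m Sigma3 in
  let W1 := invmx M1 *m Y1 in
  let W2 := invmx M2 *m Y2 in
  let W3 := invmx M3 *m Y3 in
  let B := ttm (invmx Sigma1) (invmx Sigma2) (invmx Sigma3) C in
  [/\ W1 = unfold1 F *m ((M3 ^+ 2 *m W3) *t (M2 ^+ 2 *m W2)) *m (unfold1 B)^T,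
      W2 = unfold2 F *m ((M3 ^+ 2 *m W3) *t (M1 ^+ 2 *m W1)) *m (unfold2 B)^T
    & W3 = unfold3 F *m ((M2 ^+ 2 *m W2) *t (M1 ^+ 2 *m W1)) *m (unfold3 B)^T].
Proof.
move=> spdM1 spdM2 spdM3 X [lead1 lead2 lead3] rk1 rk2 rk3 C X_C.
move=> Sigma1 Sigma2 Sigma3 Y1 Y2 Y3 W1 W2 W3 B.
have unit1 := leading_singular_values_unit lead1 rk1.
have unit2 := leading_singular_values_unit lead2 rk2.
have unit3 := leading_singular_values_unit lead3 rk3.
(* [C] is computed from [X], so [X_C] may replace only the [X] being expanded *)
split.
- rewrite unfold1_ttm.
  apply: principal_components_fixpoint lead1 _ _ _ _ _ => //.
    exact: unfold1_ttm.
  by rewrite {1}X_C; exact: unfold1_ttm.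
- rewrite unfold2_ttm.
  apply: principal_components_fixpoint lead2 _ _ _ _ _ => //.
    exact: unfold2_ttm.
  by rewrite {1}X_C; exact: unfold2_ttm.
- rewrite unfold3_ttm.
  apply: principal_components_fixpoint lead3 _ _ _ _ _ => //.
    exact: unfold3_ttm.
  by rewrite {1}X_C; exact: unfold3_ttm.
Qed.
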